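(* There exists a homeomorphism $T\colon X\to X$ of the Cantor set $X$ which is topologically mixing and completely scrambled.
   Context: Let $(X,d)$ be a compact metric space and $T\colon X\to X$ continuous. A pair $x,y\in X$ is proximal if $\liminf_{n\to\infty} d(T^n(x),T^n(y))=0$, asymptotic if $\limsup_{n\to\infty} d(T^n(x),T^n(y))=0$, and Li-Yorke if it is proximal but not asymptotic. $(X,T)$ is completely scrambled if every pair of distinct points $x,y\in X$ is a Li-Yorke pair. $(X,T)$ is topologically mixing if for any nonempty open sets $U,V\subset X$ there is $N$ such that $T^n(U)\cap V\neq\emptyset$ for all $n\geq N$. The Cantor set is the (unique up to homeomorphism) nonempty compact metric space that is zero-dimensional and has no isolated points. *)

(* Defs.v *)
From Stdlib Require Import Reals ClassicalEpsilon.
Open Scope R_scope.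

(* Model of the Cantor set: the space {0,1}^N of boolean sequences, with the
   standard metric  d(x,y) = sum_{n>=0} |x_n - y_n| / 2^(n+1). *)
Definition Cantor : Type := nat -> bool.

Definition bdiff (a b : bool) : R := if Bool.eqb a b then 0 else 1.

Definition cantor_partial (x y : Cantor) (N : nat) : R :=
  sum_f_R0 (fun n => bdiff (x n) (y n) / 2 ^ (S n)) N.

Definition cantor_dist (x y : Cantor) : R :=
  epsilon (inhabits 0) (fun r => Un_cv (cantor_partial x y) r).

Definition iterT (T : Cantor -> Cantor) (n : nat) (x : Cantor) : Cantor :=
  Nat.iter n T x.

Definition continuous_map (f : Cantor -> Cantor) : Prop :=
  forall x eps, 0 < eps -> exists delta, 0 < delta /\
    forall y, cantor_dist x y < delta -> cantor_dist (f x) (f y) < eps.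

Definition homeomorphism (T : Cantor -> Cantor) : Prop :=
  continuous_map T /\
  exists S : Cantor -> Cantor, continuous_map S /\
    (forall x, S (T x) = x) /\ (forall y, T (S y) = y).

Definition is_open (U : Cantor -> Prop) : Prop :=
  forall x, U x -> exists r, 0 < r /\ forall y, cantor_dist x y < r -> U y.

Definition topologically_mixing (T : Cantor -> Cantor) : Prop :=
  forall U V : Cantor -> Prop, is_open U -> is_open V ->
    (exists u, U u) -> (exists v, V v) ->
    exists N : nat, forall n, (N <= n)%nat ->
      exists x, U x /\ V (iterT T n x).

Definition proximal (T : Cantor -> Cantor) (x y : Cantor) : Prop :=
  forall eps, 0 < eps -> forall N : nat, exists n, (N <= n)%nat /\
    cantor_dist (iterT T n x) (iterT T n y) < eps.

Definition asymptotic (T : Cantor -> Cantor) (x y : Cantor) : Prop :=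
  forall eps, 0 < eps -> exists N : nat, forall n, (N <= n)%nat ->
    cantor_dist (iterT T n x) (iterT T n y) < eps.

Definition li_yorke_pair (T : Cantor -> Cantor) (x y : Cantor) : Prop :=
  proximal T x y /\ ~ asymptotic T x y.

Definition completely_scrambled (T : Cantor -> Cantor) : Prop :=
  forall x y : Cantor, x <> y -> li_yorke_pair T x y.

(* Main.v *)
(* Write |n| for the number of binary ones of n.  Let z be the sequence over Z with labels in
   N ∪ {∞} which is ∞ at negative times, has a label 0 at the times 2k - |k| (so that consecutive
   zeros are at distance 1 + v_2(k+1)), and has label |d| at distance d after a zero, cut off at
   the last power of two that fits into the gap.  T is the shift on the orbit closure X of z, a
   closed perfect set of bit sequences, hence a Cantor set.
   - Mixing: the prefix of z containing 2^e zeros recurs with every sufficiently large gap.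
   - Proximality: long runs of large labels occur syndetically, so any two points of X are
     simultaneously close to the fixed point ∞.
   - No asymptotic pairs: a gap of length at least m is always preceded by the same block of 2^m
     zeros, so if two points share their zeros from some time on, and there is a zero among those,
     then they are equal.  Otherwise each point is ∞ or ends in a tail n + |0|, n + |1|, n + |2|,
     ..., starting at its last zero (n = 0) or preceded only by ∞ (n > 0), and distinct tails of
     this kind differ infinitely often. *)

Require Import Defs.
From Stdlib Require Import Reals.
From Stdlib Require Import Arith ZArith Lia Lra Classical ClassicalEpsilon.
From Stdlib Require Import FunctionalExtensionality.
From Stdlib Require Cantor.

Local Open Scope nat_scope.

(** * Binary digit sums *)

Fixpoint pos_popcount (p : positive) : nat :=
  match p with
  | xH => 1
  | xO p => pos_popcount p
  | xI p => S (pos_popcount p)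
  end.

Definition popcount (n : nat) : nat :=
  match N.of_nat n with N0 => 0 | Npos p => pos_popcount p end.

Lemma popcount_double n : popcount (2 * n) = popcount n.
Proof.
  unfold popcount. rewrite Nnat.Nat2N.inj_double.
  now destruct (N.of_nat n).
Qed.

Lemma popcount_double_S n : popcount (2 * n + 1) = S (popcount n).
Proof.
  unfold popcount. rewrite Nat.add_1_r, Nnat.Nat2N.inj_succ_double.
  now destruct (N.of_nat n).
Qed.

Lemma binary_ind (Q : nat -> Prop) :
  Q 0 -> (forall n, 0 < n -> Q n -> Q (2 * n)) ->
  (forall n, Q n -> Q (2 * n + 1)) -> forall n, Q n.
Proof.
  intros H0 He Ho n. induction n as [n IH] using lt_wf_ind.
  destruct (Nat.Even_or_Odd n) as [[m ->]|[m ->]].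
  - destruct m; [exact H0|]. apply He; [lia|]. apply IH. lia.
  - apply Ho, IH. lia.
Qed.

Lemma popcount_pos n : 0 < n -> 0 < popcount n.
Proof.
  induction n as [|n Hn IH|n IH] using binary_ind; intros H.
  - lia.
  - rewrite popcount_double. auto.
  - rewrite popcount_double_S. lia.
Qed.

Lemma popcount_le n : popcount n <= n.
Proof.
  induction n as [|n Hn IH|n IH] using binary_ind.
  - reflexivity.
  - rewrite popcount_double. lia.
  - rewrite popcount_double_S. lia.
Qed.

Lemma popcount_S n : popcount (S n) <= S (popcount n).
Proof.
  induction n as [|n Hn IH|n IH] using binary_ind.
  - reflexivity.
  - replace (S (2 * n)) with (2 * n + 1) by lia.
    rewrite popcount_double_S, popcount_double. lia.
  - replace (S (2 * n + 1)) with (2 * S n) by lia.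
    rewrite popcount_double_S, popcount_double. lia.
Qed.

(** The binary expansions of [c] and [r] are juxtaposed without carry. The induction strips the
    lowest digit of [r]. *)
Lemma popcount_concat c e r :
  r < 2 ^ e -> popcount (c * 2 ^ e + r) = popcount c + popcount r.
Proof.
  revert r. induction e as [|e IH]; intros r Hr.
  - simpl in Hr. replace r with 0 by lia.
    replace (c * 2 ^ 0 + 0) with c by (simpl; lia).
    change (popcount 0) with 0. lia.
  - rewrite Nat.pow_succ_r' in *.
    destruct (Nat.Even_or_Odd r) as [[m ->]|[m ->]].
    + replace (c * (2 * 2 ^ e) + 2 * m) with (2 * (c * 2 ^ e + m)) by lia.
      rewrite !popcount_double. apply IH. lia.
    + replace (c * (2 * 2 ^ e) + (2 * m + 1)) with (2 * (c * 2 ^ e + m) + 1) by lia.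
      rewrite !popcount_double_S, IH; lia.
Qed.

Lemma pow2_pos e : 0 < 2 ^ e.
Proof. apply Nat.neq_0_lt_0, Nat.pow_nonzero. lia. Qed.

Lemma popcount_shift c e : popcount (c * 2 ^ e) = popcount c.
Proof.
  rewrite <- (Nat.add_0_r (c * 2 ^ e)), popcount_concat by apply pow2_pos.
  change (popcount 0) with 0. lia.
Qed.

Lemma popcount_pow2 e : popcount (2 ^ e) = 1.
Proof. now rewrite <- (Nat.mul_1_l (2 ^ e)), popcount_shift. Qed.

Lemma popcount_ones e : popcount (2 ^ e - 1) = e.
Proof.
  induction e as [|e IH]; [reflexivity|].
  assert (H := pow2_pos e). rewrite Nat.pow_succ_r'.
  replace (2 * 2 ^ e - 1) with (2 * (2 ^ e - 1) + 1) by lia.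
  rewrite popcount_double_S. lia.
Qed.

(** Borrowing leaves ones at all binary positions from [f] to [e - 1]. *)
Lemma popcount_below_multiple c e f j :
  0 < c -> 0 < j <= 2 ^ f -> f <= e -> e - f <= popcount (c * 2 ^ e - j).
Proof.
  intros Hc Hj Hfe.
  assert (He : 2 ^ e = 2 ^ (e - f) * 2 ^ f)
    by (rewrite <- Nat.pow_add_r; f_equal; lia).
  assert (H1 := pow2_pos (e - f)). assert (H2 := pow2_pos f).
  replace (c * 2 ^ e - j) with
    ((c - 1) * 2 ^ e + ((2 ^ (e - f) - 1) * 2 ^ f + (2 ^ f - j))) by nia.
  rewrite popcount_concat by nia.
  rewrite popcount_concat by nia.
  rewrite popcount_ones. lia.
Qed.

(** * The sequence z *)

(* By Legendre's formula this is the sum of 1 + v_2(i) over 1 <= i <= k, so [gap k] is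
   1 + v_2(k+1). *)
Definition zero_pos (k : nat) : nat := 2 * k - popcount k.
Definition gap (k : nat) : nat := zero_pos (S k) - zero_pos k.

Lemma zero_pos_S k : zero_pos (S k) = zero_pos k + gap k /\ 0 < gap k.
Proof.
  unfold gap, zero_pos.
  assert (H1 := popcount_S k). assert (H2 := popcount_le k).
  assert (H3 := popcount_le (S k)). lia.
Qed.

Lemma zero_pos_lt k l : k < l -> zero_pos k + gap k <= zero_pos l.
Proof.
  induction 1 as [|l _ IH].
  - now rewrite (proj1 (zero_pos_S k)).
  - destruct (zero_pos_S l). lia.
Qed.

(** Digit sums add up under concatenation, so every aligned group of [2 ^ e] zeros is a translate of
    the first one. This self-similarity is the source of all recurrence below. *)
Lemma zero_pos_block c e k :
  k < 2 ^ e -> zero_pos (c * 2 ^ e + k) = zero_pos (c * 2 ^ e) + zero_pos k.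
Proof.
  intros Hk. unfold zero_pos. rewrite popcount_concat, popcount_shift by trivial.
  assert (H1 := popcount_le k). assert (H2 := popcount_le c).
  assert (H3 := pow2_pos e). nia.
Qed.

(** The bound is on [S k] because the gap after the last zero of a group depends on [c]. *)
Lemma gap_block c e k : S k < 2 ^ e -> gap (c * 2 ^ e + k) = gap k.
Proof.
  intros Hk. unfold gap. rewrite <- Nat.add_succ_r, !zero_pos_block by lia. lia.
Qed.

(** One half of the formula 1 + v_2(k+1) for [gap k]: the number [c * 2 ^ e - 1] ends in [e] ones,
    so its digit sum drops by at least e - 1 at the next step. *)
Lemma gap_before_multiple c e :
  0 < c -> e < gap (c * 2 ^ e - 1).
Proof.
  intros Hc. assert (H := pow2_pos e).
  unfold gap, zero_pos. replace (S (c * 2 ^ e - 1)) with (c * 2 ^ e) by nia.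
  replace (c * 2 ^ e - 1) with ((c - 1) * 2 ^ e + (2 ^ e - 1)) by nia.
  rewrite popcount_concat, popcount_ones, popcount_shift by lia.
  assert (H1 := popcount_S (c - 1)). replace (S (c - 1)) with c in H1 by lia.
  assert (H2 := popcount_le (c - 1)). assert (H3 := popcount_le c).
  assert (H4 : e < 2 ^ e) by (apply Nat.pow_gt_lin_r; lia).
  nia.
Qed.

(** The other half: if [S k] were an odd multiple of [2 ^ m], the gap would be exactly m + 1. *)
Lemma gap_large_multiple k m : m < gap k -> exists c, S k = c * 2 ^ m.
Proof.
  induction m as [|m IH]; intros Hm.
  - exists (S k). simpl. lia.
  - destruct IH as [c Hc]; [lia|].
    destruct (Nat.Even_or_Odd c) as [[b ->]|[b ->]].
    + exists b. rewrite Hc. simpl. lia.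
    + exfalso. assert (H := pow2_pos m).
      unfold gap, zero_pos in Hm.
      replace k with (2 * b * 2 ^ m + (2 ^ m - 1)) in Hm at 3 4 by nia.
      rewrite popcount_concat, popcount_ones, Hc, popcount_shift, popcount_double_S,
        popcount_double in Hm by lia.
      assert (H2 := popcount_le b).
      assert (H4 : m < 2 ^ m) by (apply Nat.pow_gt_lin_r; lia).
      nia.
Qed.

Lemma zero_pos_cover t : exists k d, d < gap k /\ t = zero_pos k + d.
Proof.
  induction t as [|t (k & d & Hd & ->)].
  - exists 0, 0. split; [apply zero_pos_S|reflexivity].
  - destruct (Nat.eq_dec (S d) (gap k)) as [E|E].
    + exists (S k), 0. destruct (zero_pos_S k), (zero_pos_S (S k)). lia.
    + exists k, (S d). lia.
Qed.

Lemma zero_pos_unique k d k' d' :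
  d < gap k -> d' < gap k' -> zero_pos k + d = zero_pos k' + d' -> k = k' /\ d = d'.
Proof.
  intros Hd Hd' E.
  destruct (Nat.lt_trichotomy k k') as [H|[->|H]].
  - apply zero_pos_lt in H. lia.
  - lia.
  - apply zero_pos_lt in H. lia.
Qed.

(** [D] is the length of the gap and [d] the distance from its left end. The constant value after
    the cutoff keeps the labels large up to the next zero. *)
Definition label (D d : nat) : nat :=
  if d <? 2 ^ Nat.log2 D then popcount d else Nat.log2 D.

Lemma label_small D d : d < 2 ^ Nat.log2 D -> label D d = popcount d.
Proof. intros H. unfold label. now apply Nat.ltb_lt in H as ->. Qed.

Lemma label_half D d : 2 * d < D -> label D d = popcount d.
Proof.
  intros H. apply label_small.
  destruct (Nat.log2_spec D ltac:(lia)) as [_ H2]. simpl in H2. lia.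
Qed.

Lemma label_large D d : 2 ^ Nat.log2 D <= d -> label D d = Nat.log2 D.
Proof. intros H. unfold label. now apply Nat.ltb_ge in H as ->. Qed.

Lemma label_pos D d : 0 < d < D -> 0 < label D d.
Proof.
  intros H. unfold label. destruct (d <? _).
  - now apply popcount_pos.
  - apply Nat.log2_pos. lia.
Qed.

Lemma label_0 D : label D 0 = 0.
Proof. apply label_small, pow2_pos. Qed.

Lemma label_below_multiple D c e f j :
  0 < c -> 2 ^ e <= D -> 0 < j <= 2 ^ f -> f <= e -> e - f <= label D (c * 2 ^ e - j).
Proof.
  intros Hc HD Hj Hf.
  assert (He : e <= Nat.log2 D).
  { apply Nat.log2_le_mono in HD. now rewrite Nat.log2_pow2 in HD by lia. }
  unfold label. destruct (_ <? _).
  - now apply popcount_below_multiple.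
  - lia.
Qed.

(** Either [D - j] is past the cutoff, or it is at most [j] below the power of two at which the
    cutoff occurs, where the digit sum is large. *)
Lemma label_end D f e j :
  2 ^ e <= D -> f <= e -> 0 < j <= 2 ^ f -> e - f <= label D (D - j).
Proof.
  intros HD Hf Hj.
  assert (He : e <= Nat.log2 D).
  { apply Nat.log2_le_mono in HD. now rewrite Nat.log2_pow2 in HD by lia. }
  assert (HD0 : 0 < D) by (assert (H := pow2_pos e); lia).
  destruct (Nat.log2_spec D HD0) as [H1 _].
  assert (H2 : 2 ^ f <= 2 ^ Nat.log2 D) by (apply Nat.pow_le_mono_r; lia).
  destruct (Nat.le_gt_cases (2 ^ Nat.log2 D) (D - j)) as [H|H].
  - rewrite label_large by trivial. lia.
  - replace (D - j) with (1 * 2 ^ Nat.log2 D - (2 ^ Nat.log2 D + j - D)) by lia.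
    transitivity (Nat.log2 D - f); [lia|].
    apply label_below_multiple; lia.
Qed.
(* [x t n = true] means that the label of [x] at time [t] is [n]; the label is infinite if no bit
   of [x t] is set. *)
Definition point : Type := Z -> nat -> bool.

(** This is the sequence z. At negative times there are no such [k] and [d], so no bit is set and
    the label is infinite. *)
Definition base : Z -> nat -> bool := fun t n =>
  if excluded_middle_informative
       (exists k d, d < gap k /\ t = Z.of_nat (zero_pos k + d) /\ label (gap k) d = n)
  then true else false.

Lemma base_gap k d n :
  d < gap k -> base (Z.of_nat (zero_pos k + d)) n = (label (gap k) d =? n).
Proof.
  intros Hd. unfold base. destruct excluded_middle_informative as [(k' & d' & Hd' & E & <-)|H].
  - apply Nat2Z.inj in E. destruct (zero_pos_unique _ _ _ _ Hd Hd' E) as [-> ->].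
    symmetry. apply Nat.eqb_refl.
  - symmetry. apply Nat.eqb_neq. intros E. apply H. eauto.
Qed.

Lemma base_neg t n : (t < 0)%Z -> base t n = false.
Proof.
  intros Ht. unfold base. destruct excluded_middle_informative as [(k & d & _ & E & _)|]; [lia|easy].
Qed.

Lemma base_cases t :
  (t < 0)%Z \/ exists k d, d < gap k /\ t = Z.of_nat (zero_pos k + d).
Proof.
  destruct (Z.lt_ge_cases t 0) as [H|H]; [now left|right].
  destruct (zero_pos_cover (Z.to_nat t)) as (k & d & Hd & E).
  exists k, d. split; [trivial|lia].
Qed.

Lemma base_zero_pos k : base (Z.of_nat (zero_pos k)) 0 = true.
Proof.
  rewrite <- (Nat.add_0_r (zero_pos k)), base_gap, label_0 by apply zero_pos_S. reflexivity.
Qed.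

Lemma base_zero_inv t : base t 0 = true -> exists k, t = Z.of_nat (zero_pos k).
Proof.
  intros H. destruct (base_cases t) as [Ht|(k & d & Hd & ->)].
  - rewrite base_neg in H; easy.
  - rewrite base_gap in H by trivial. apply Nat.eqb_eq in H.
    exists k. destruct d; [f_equal; lia|].
    assert (0 < label (gap k) (S d)) by (apply label_pos; lia). lia.
Qed.

Lemma base_nonzero k d : 0 < d < gap k -> base (Z.of_nat (zero_pos k + d)) 0 = false.
Proof.
  intros H. rewrite base_gap by lia. apply Nat.eqb_neq.
  assert (0 < label (gap k) d) by (apply label_pos; lia). lia.
Qed.

(** This lemma and the next one express the length of a gap by the absence of zeros in a window, a
    condition that carries over to limits of shifts of [base]. *)
Lemma gap_gt_of_nonzero k m :
  (forall i, 0 < i <= m -> base (Z.of_nat (zero_pos k) + Z.of_nat i) 0 = false) -> m < gap k.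
Proof.
  intros H. destruct (Nat.lt_ge_cases m (gap k)) as [|Hm]; [trivial|].
  destruct (zero_pos_S k) as [E Hg].
  specialize (H (gap k) ltac:(lia)).
  rewrite <- Nat2Z.inj_add, <- E, base_zero_pos in H. easy.
Qed.

Lemma gap_gt_of_nonzero_before k m :
  (forall i, 0 < i <= m -> base (Z.of_nat (zero_pos (S k)) - Z.of_nat i) 0 = false) -> m < gap k.
Proof.
  intros H. destruct (Nat.lt_ge_cases m (gap k)) as [|Hm]; [trivial|].
  destruct (zero_pos_S k) as [E Hg].
  specialize (H (gap k) ltac:(lia)).
  replace (Z.of_nat (zero_pos (S k)) - Z.of_nat (gap k))%Z
    with (Z.of_nat (zero_pos k)) in H by lia.
  rewrite base_zero_pos in H. easy.
Qed.

(* The prefix of [base] with [2 ^ m] zeros occupies the times [0 .. block_length m]. *)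
Definition block_length (m : nat) : nat := zero_pos (2 ^ m - 1).

Lemma base_block c m i n :
  i <= block_length m ->
  base (Z.of_nat (zero_pos (c * 2 ^ m) + i)) n = base (Z.of_nat i) n.
Proof.
  unfold block_length. intros Hi. assert (Hp := pow2_pos m).
  destruct (zero_pos_cover i) as (k & d & Hd & ->).
  destruct (Nat.lt_trichotomy k (2 ^ m - 1)) as [H|[H|H]].
  - rewrite Nat.add_assoc, <- zero_pos_block, !base_gap; rewrite ?gap_block; lia || trivial.
  (* Of the last zero of the block only the zero itself is compared; the gap after it may differ
     from the one in the prefix. *)
  - assert (d = 0) as -> by (subst; lia).
    rewrite Nat.add_assoc, <- zero_pos_block by lia.
    rewrite !base_gap by apply zero_pos_S. now rewrite !label_0.
  - apply zero_pos_lt in H. destruct (zero_pos_S (2 ^ m - 1)). lia.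
Qed.

(** By [gap_large_multiple] a zero followed by a gap longer than [m] is the last one of an aligned
    block of [2 ^ m] zeros. The gap before that block is longer than [m] as well, unless the block
    is the initial one, which is preceded by negative times. *)
Lemma base_block_end q m :
  base q 0 = true -> (forall i, 0 < i <= m -> base (q + Z.of_nat i) 0 = false) ->
  (forall i n, i <= block_length m ->
     base (q - Z.of_nat (block_length m) + Z.of_nat i) n = base (Z.of_nat i) n) /\
  (forall i, 0 < i <= m ->
     base (q - Z.of_nat (block_length m) - Z.of_nat i) 0 = false).
Proof.
  intros Hq Hr. apply base_zero_inv in Hq as [k ->].
  apply gap_gt_of_nonzero in Hr. apply gap_large_multiple in Hr as [c Hc].
  assert (Hp := pow2_pos m).
  assert (Hc0 : 0 < c) by (destruct c; lia).
  assert (E : zero_pos k = zero_pos ((c - 1) * 2 ^ m) + block_length m).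
  { unfold block_length. rewrite <- zero_pos_block by lia. f_equal. nia. }
  rewrite E.
  replace (Z.of_nat (zero_pos ((c - 1) * 2 ^ m) + block_length m) - Z.of_nat (block_length m))%Z
    with (Z.of_nat (zero_pos ((c - 1) * 2 ^ m))) by lia.
  split.
  - intros i n Hi. rewrite <- Nat2Z.inj_add. now apply base_block.
  - intros i Hi. destruct (Nat.eq_dec c 1) as [->|Hc1].
    + apply base_neg. change (zero_pos ((1 - 1) * 2 ^ m)) with 0. lia.
    + assert (Hg := gap_before_multiple (c - 1) m ltac:(lia)).
      destruct (zero_pos_S ((c - 1) * 2 ^ m - 1)) as [E' _].
      replace (S ((c - 1) * 2 ^ m - 1)) with ((c - 1) * 2 ^ m) in E' by nia.
      rewrite E', <- (base_nonzero ((c - 1) * 2 ^ m - 1) (gap ((c - 1) * 2 ^ m - 1) - i)) by lia.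
      f_equal. lia.
Qed.

(** The witness is the last zero of the aligned block of [2 ^ m] zeros that contains the given
    one. *)
Lemma base_next_block_end i m :
  base i 0 = true -> exists q, (i <= q <= i + Z.of_nat (block_length m))%Z /\
    base q 0 = true /\ forall j, 0 < j <= m -> base (q + Z.of_nat j) 0 = false.
Proof.
  intros Hi. apply base_zero_inv in Hi as [k ->].
  assert (Hp := pow2_pos m).
  assert (Hdiv := Nat.div_mod_eq k (2 ^ m)).
  assert (Hmod := Nat.mod_upper_bound k (2 ^ m) ltac:(lia)).
  set (c := k / 2 ^ m) in *. set (r := k mod 2 ^ m) in *.
  exists (Z.of_nat (zero_pos (c * 2 ^ m + (2 ^ m - 1)))).
  split; [|split].
  - replace k with (c * 2 ^ m + r) by lia.
    rewrite !zero_pos_block by lia. unfold block_length.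
    assert (zero_pos r <= zero_pos (2 ^ m - 1)).
    { destruct (Nat.eq_dec r (2 ^ m - 1)) as [->|]; [lia|].
      assert (H := zero_pos_lt r (2 ^ m - 1) ltac:(lia)). lia. }
    lia.
  - apply base_zero_pos.
  - intros j Hj. rewrite <- Nat2Z.inj_add. apply base_nonzero.
    assert (H := gap_before_multiple (S c) m ltac:(lia)).
    replace (S c * 2 ^ m - 1) with (c * 2 ^ m + (2 ^ m - 1)) in H by nia. lia.
Qed.

Lemma base_before_zero s m e f j n :
  base s 0 = true -> (forall i, 0 < i <= m -> base (s - Z.of_nat i) 0 = false) ->
  2 ^ e <= S m -> f <= e -> 0 < j <= 2 ^ f -> n < e - f ->
  base (s - Z.of_nat j) n = false.
Proof.
  intros Hs Hm He Hf Hj Hn. apply base_zero_inv in Hs as [k ->].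
  destruct k as [|k].
  - apply base_neg. change (zero_pos 0) with 0. lia.
  - apply gap_gt_of_nonzero_before in Hm.
    destruct (zero_pos_S k) as [E _].
    assert (2 ^ f <= 2 ^ e) by (apply Nat.pow_le_mono_r; lia).
    replace (Z.of_nat (zero_pos (S k)) - Z.of_nat j)%Z
      with (Z.of_nat (zero_pos k + (gap k - j))) by lia.
    rewrite base_gap by lia. apply Nat.eqb_neq.
    assert (e - f <= label (gap k) (gap k - j)) by (apply label_end; lia). lia.
Qed.

Lemma base_after_zero s m j n :
  base s 0 = true -> (forall i, 0 < i <= m -> base (s + Z.of_nat i) 0 = false) ->
  2 * j <= m -> base (s + Z.of_nat j) n = (popcount j =? n).
Proof.
  intros Hs Hm Hj. apply base_zero_inv in Hs as [k ->].
  apply gap_gt_of_nonzero in Hm.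
  rewrite <- Nat2Z.inj_add, base_gap, label_half by lia. reflexivity.
Qed.

(* Clearing the lowest binary digit of [d] lowers [popcount] by one, so a local minimum of
   [popcount] has many trailing zeros. *)
Lemma popcount_min_multiple d e :
  (forall v, v < e -> 2 ^ v <= d -> popcount d <= popcount (d - 2 ^ v)) ->
  exists c, d = c * 2 ^ e.
Proof.
  induction e as [|e IH]; intros H.
  - exists d. simpl. lia.
  - destruct IH as [c ->]; [auto|].
    assert (Hp := pow2_pos e).
    destruct (Nat.Even_or_Odd c) as [[b ->]|[b ->]].
    + exists b. simpl. lia.
    + specialize (H e ltac:(lia) ltac:(nia)).
      replace ((2 * b + 1) * 2 ^ e - 2 ^ e) with (2 * b * 2 ^ e) in H by nia.
      rewrite !popcount_shift, popcount_double, popcount_double_S in H. lia.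
Qed.

Lemma base_around_minimum t n e :
  base t n = true -> n < e ->
  (forall i, (- 2 ^ Z.of_nat (S e) <= i <= 2 ^ Z.of_nat (S e))%Z -> base (t + i) 0 = false) ->
  (forall i m, (- 2 ^ Z.of_nat (S e) <= i <= 0)%Z -> m < n -> base (t + i) m = false) ->
  (forall j m, j < 2 ^ e -> base (t + Z.of_nat j) m = (n + popcount j =? m)) /\
  (forall f j m, f <= e -> 0 < j <= 2 ^ f -> m < e - f -> base (t - Z.of_nat j) m = false).
Proof.
  intros Ht Hne Hz Hmin.
  replace (2 ^ Z.of_nat (S e))%Z with (Z.of_nat (2 ^ S e)) in * by now rewrite Nat2Z.inj_pow.
  destruct (base_cases t) as [H|(k & d & Hd & ->)].
  { rewrite base_neg in Ht; easy. }
  destruct (zero_pos_S k) as [E _]. assert (Hp := pow2_pos e).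
  rewrite Nat.pow_succ_r' in Hz, Hmin.
  assert (Hd1 : 2 * 2 ^ e < d).
  { destruct (Nat.lt_ge_cases (2 * 2 ^ e) d) as [|H]; [trivial|].
    specialize (Hz (- Z.of_nat d)%Z ltac:(lia)).
    replace (Z.of_nat (zero_pos k + d) + - Z.of_nat d)%Z with (Z.of_nat (zero_pos k)) in Hz by lia.
    now rewrite base_zero_pos in Hz. }
  assert (Hd2 : d + 2 * 2 ^ e < gap k).
  { destruct (Nat.lt_ge_cases (d + 2 * 2 ^ e) (gap k)) as [|H]; [trivial|].
    specialize (Hz (Z.of_nat (gap k) - Z.of_nat d)%Z ltac:(lia)).
    replace (Z.of_nat (zero_pos k + d) + (Z.of_nat (gap k) - Z.of_nat d))%Z
      with (Z.of_nat (zero_pos (S k))) in Hz by lia.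
    now rewrite base_zero_pos in Hz. }
  rewrite base_gap in Ht by trivial. apply Nat.eqb_eq in Ht.
  set (a := Nat.log2 (gap k)) in *.
  assert (Ha : S e <= a).
  { unfold a. rewrite <- (Nat.log2_pow2 (S e)) by lia. apply Nat.log2_le_mono. simpl. lia. }
  (* After the cutoff the label would be [a], which exceeds [n]. *)
  assert (Hda : d < 2 ^ a).
  { destruct (Nat.lt_ge_cases d (2 ^ a)) as [|H]; [trivial|].
    rewrite label_large in Ht by trivial. fold a in Ht. lia. }
  rewrite label_small in Ht by trivial.
  destruct (popcount_min_multiple d e) as [c Hc].
  { intros v Hv Hvd.
    assert (Hve : 2 ^ v <= 2 ^ e) by (apply Nat.pow_le_mono_r; lia).
    destruct (Nat.le_gt_cases (popcount d) (popcount (d - 2 ^ v))) as [|H]; [trivial|].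
    specialize (Hmin (- Z.of_nat (2 ^ v))%Z (popcount (d - 2 ^ v)) ltac:(lia) ltac:(lia)).
    replace (Z.of_nat (zero_pos k + d) + - Z.of_nat (2 ^ v))%Z
      with (Z.of_nat (zero_pos k + (d - 2 ^ v))) in Hmin by lia.
    rewrite base_gap, label_small, Nat.eqb_refl in Hmin by (fold a; lia). easy. }
  (* The cutoff [2 ^ a] is a multiple of [2 ^ e] too, so [d + j] stays below it for [j < 2 ^ e]. *)
  assert (Hae : 2 ^ a = 2 ^ (a - e) * 2 ^ e) by (rewrite <- Nat.pow_add_r; f_equal; lia).
  assert (Hca : c < 2 ^ (a - e)) by nia.
  split.
  - intros j m Hj.
    rewrite <- Nat2Z.inj_add, <- Nat.add_assoc, base_gap by lia.
    rewrite label_small by (fold a; nia).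
    rewrite <- Ht, Hc, popcount_concat, popcount_shift by trivial. reflexivity.
  - intros f j m Hf Hj Hm.
    assert (Hfe : 2 ^ f <= 2 ^ e) by (apply Nat.pow_le_mono_r; lia).
    replace (Z.of_nat (zero_pos k + d) - Z.of_nat j)%Z
      with (Z.of_nat (zero_pos k + (d - j))) by lia.
    rewrite base_gap by lia. apply Nat.eqb_neq.
    assert (e - f <= label (gap k) (d - j)); [|lia].
    rewrite Hc. apply label_below_multiple; lia.
Qed.

Lemma base_high_in_nonzero r e f :
  (forall i, (0 <= i <= 2 ^ Z.of_nat (S e))%Z -> base (r + i) 0 = false) -> f <= e ->
  exists i, (0 <= i <= 2 ^ Z.of_nat (S e))%Z /\
    forall j n, 0 < j <= 2 ^ f -> n < e - f -> base (r + i - Z.of_nat j) n = false.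
Proof.
  replace (2 ^ Z.of_nat (S e))%Z with (Z.of_nat (2 ^ S e)) in * by now rewrite Nat2Z.inj_pow.
  rewrite Nat.pow_succ_r'. assert (Hp := pow2_pos e).
  intros Hz Hf. destruct (base_cases r) as [H|(k & d & Hd & ->)].
  { exists 0%Z. split; [lia|]. intros j n Hj _. apply base_neg. lia. }
  destruct (zero_pos_S k) as [E _].
  assert (Hd2 : d + 2 * 2 ^ e < gap k).
  { destruct (Nat.lt_ge_cases (d + 2 * 2 ^ e) (gap k)) as [|H]; [trivial|].
    specialize (Hz (Z.of_nat (gap k) - Z.of_nat d)%Z ltac:(lia)).
    replace (Z.of_nat (zero_pos k + d) + (Z.of_nat (gap k) - Z.of_nat d))%Z
      with (Z.of_nat (zero_pos (S k))) in Hz by lia.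
    now rewrite base_zero_pos in Hz. }
  assert (Hdiv := Nat.div_mod_eq d (2 ^ e)).
  assert (Hmod := Nat.mod_upper_bound d (2 ^ e) ltac:(lia)).
  set (c := d / 2 ^ e) in *. set (s := d mod 2 ^ e) in *.
  assert (Hfe : 2 ^ f <= 2 ^ e) by (apply Nat.pow_le_mono_r; lia).
  (* This moves to the multiple [(c + 2) * 2 ^ e], which exceeds [d] by at most [2 * 2 ^ e] and so
     is still inside the gap. *)
  exists (Z.of_nat ((c + 2) * 2 ^ e - d)). split; [nia|].
  intros j n Hj Hn.
  replace (Z.of_nat (zero_pos k + d) + Z.of_nat ((c + 2) * 2 ^ e - d) - Z.of_nat j)%Z
    with (Z.of_nat (zero_pos k + ((c + 2) * 2 ^ e - j))) by nia.
  rewrite base_gap by nia. apply Nat.eqb_neq.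
  assert (e - f <= label (gap k) ((c + 2) * 2 ^ e - j)); [|lia].
  apply label_below_multiple; lia.
Qed.

(** A window of length [M] without zeros contains a suitable time. If the window at [r] has a zero,
    the end of a block of [2 ^ S M] zeros follows within [block_length (S M)], and the window just
    after it is free of zeros. *)
Lemma base_high_syndetic e f :
  f <= e -> exists L, forall r, exists i, (0 <= i <= Z.of_nat L)%Z /\
    forall j n, 0 < j <= 2 ^ f -> n < e - f -> base (r + i - Z.of_nat j) n = false.
Proof.
  intros Hf. set (M := 2 ^ S e).
  assert (EM : (2 ^ Z.of_nat (S e))%Z = Z.of_nat M).
  { unfold M. now rewrite Nat2Z.inj_pow. }
  assert (R := fun r => base_high_in_nonzero r e f). rewrite EM in R.
  exists (M + 1 + block_length (S M) + M). intros r.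
  destruct (classic (forall i, (0 <= i <= Z.of_nat M)%Z -> base (r + i) 0 = false))
    as [H|H].
  - destruct (R r H Hf) as (i & Hi & Hl). exists i. split; [lia|trivial].
  - apply not_all_ex_not in H as [i H]. apply imply_to_and in H as [Hi H].
    apply Bool.not_false_is_true in H.
    destruct (base_next_block_end _ (S M) H) as (q & Hq & _ & Hz).
    destruct (R (q + 1)%Z) as (i' & Hi' & Hl); trivial.
    + intros i' Hi'. rewrite <- (Hz (S (Z.to_nat i'))) by lia. f_equal. lia.
    + exists (q + 1 + i' - r)%Z. split; [lia|].
      intros j n Hj Hn. rewrite <- (Hl j n Hj Hn). f_equal. lia.
Qed.

(** * The orbit closure of z *)

Definition shift (s : Z) (x : point) : point := fun t n => x (s + t)%Z n.

Definition agree (N : nat) (x y : point) : Prop :=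
  forall t n, (Z.abs t <= Z.of_nat N)%Z -> n <= N -> x t n = y t n.

(* [x] lies in the orbit closure of [base]. *)
Definition orbit_closure (x : point) : Prop :=
  forall N, exists s, agree N x (shift s base).

Lemma base_recurrence N s :
  exists e, forall c, agree N (shift (Z.of_nat (zero_pos (c * 2 ^ e)) + s) base) (shift s base).
Proof.
  (* [U] bounds all times that occur. A gap longer than [2 ^ (S U + U)] has labels at least [S U]
     during its last [2 ^ U] steps, which for labels up to [N] looks like infinity. *)
  set (U := Z.to_nat (Z.abs s) + N).
  exists (2 ^ (S U + U)). intros c t n Ht Hn. unfold shift.
  set (e := 2 ^ (S U + U)).
  assert (HU : U < 2 ^ U) by (apply Nat.pow_gt_lin_r; lia).
  assert (HUe : U < e).
  { transitivity (S U + U); [lia|apply Nat.pow_gt_lin_r; lia]. }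
  destruct (Z.lt_ge_cases (s + t) 0) as [H|H].
  - rewrite (base_neg (s + t)) by trivial.
    destruct (Nat.eq_dec c 0) as [->|Hc].
    { apply base_neg. change (zero_pos (0 * 2 ^ e)) with 0. lia. }
    assert (Hg := gap_before_multiple c e ltac:(lia)).
    destruct (zero_pos_S (c * 2 ^ e - 1)) as [E _].
    assert (Hp := pow2_pos e).
    replace (S (c * 2 ^ e - 1)) with (c * 2 ^ e) in E by nia.
    replace (Z.of_nat (zero_pos (c * 2 ^ e)) + s + t)%Z with
      (Z.of_nat (zero_pos (c * 2 ^ e - 1) +
        (gap (c * 2 ^ e - 1) - Z.to_nat (- (s + t))))) by lia.
    rewrite base_gap by lia. apply Nat.eqb_neq.
    assert (S U + U - U <= label (gap (c * 2 ^ e - 1))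
              (gap (c * 2 ^ e - 1) - Z.to_nat (- (s + t)))).
    { apply label_end; [fold e; lia|lia|lia]. }
    lia.
  - replace (Z.of_nat (zero_pos (c * 2 ^ e)) + s + t)%Z with
      (Z.of_nat (zero_pos (c * 2 ^ e) + Z.to_nat (s + t))) by lia.
    rewrite base_block; [f_equal; lia|].
    unfold block_length, zero_pos. rewrite popcount_ones.
    assert (e < 2 ^ e) by (apply Nat.pow_gt_lin_r; lia). lia.
Qed.
Lemma orbit_closure_window x (N : Z) n :
  orbit_closure x -> exists s, forall t m, (Z.abs t <= N)%Z -> m <= n -> x t m = base (s + t) m.
Proof.
  intros Hx. destruct (Hx (Z.to_nat N + n)) as [s Hs]. exists s.
  intros t m Ht Hm. apply Hs; lia.
Qed.

Lemma orbit_closure_shift x s : orbit_closure x -> orbit_closure (shift s x).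
Proof.
  intros Hx N. destruct (orbit_closure_window x (Z.abs s + Z.of_nat N) N Hx) as [r Hr].
  exists (r + s)%Z. intros t n Ht Hn. unfold shift. rewrite Hr by lia. f_equal. lia.
Qed.

Lemma orbit_closure_shift_base s : orbit_closure (shift s base).
Proof. intros N. now exists s. Qed.

Lemma orbit_closure_block_end x q m :
  orbit_closure x -> x q 0 = true ->
  (forall i, 0 < i <= m -> x (q + Z.of_nat i)%Z 0 = false) ->
  (forall i n, i <= block_length m ->
     x (q - Z.of_nat (block_length m) + Z.of_nat i)%Z n = base (Z.of_nat i) n) /\
  (forall i, 0 < i <= m ->
     x (q - Z.of_nat (block_length m) - Z.of_nat i)%Z 0 = false).
Proof.
  intros Hx Hq Hm.
  (* A shift of [base] matches [x] only up to a bound on the labels, so it is chosen anew for each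
     [n]. *)
  assert (W : forall n, exists s,
    (forall t, (Z.abs t <= Z.abs q + Z.of_nat (block_length m) + Z.of_nat m)%Z ->
       forall k, k <= n -> x t k = base (s + t) k) /\
    base (s + q) 0 = true /\
    (forall i, 0 < i <= m -> base (s + q + Z.of_nat i) 0 = false)).
  { intros n. destruct (orbit_closure_window x
      (Z.abs q + Z.of_nat (block_length m) + Z.of_nat m) n Hx) as [s Hs].
    exists s. split; [auto|split].
    - rewrite <- Hs by lia. trivial.
    - intros i Hi. rewrite <- Z.add_assoc, <- Hs by lia. auto. }
  split.
  - intros i n Hi. destruct (W n) as (s & Hs & Hz & Hg).
    destruct (base_block_end _ _ Hz Hg) as [H _].
    rewrite Hs, <- (H i n Hi) by lia. f_equal. lia.
  - intros i Hi. destruct (W 0) as (s & Hs & Hz & Hg).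
    destruct (base_block_end _ _ Hz Hg) as [_ H].
    rewrite Hs, <- (H i Hi) by lia. f_equal. lia.
Qed.

Lemma orbit_closure_next_block_end x i m :
  orbit_closure x -> x i 0 = true ->
  exists q, (i <= q <= i + Z.of_nat (block_length m))%Z /\
    x q 0 = true /\ forall j, 0 < j <= m -> x (q + Z.of_nat j)%Z 0 = false.
Proof.
  intros Hx Hi.
  destruct (orbit_closure_window x
    (Z.abs i + Z.of_nat (block_length m) + Z.of_nat m) 0 Hx) as [s Hs].
  rewrite Hs in Hi by lia.
  destruct (base_next_block_end _ m Hi) as (q & Hq & Hz & Hg).
  exists (q - s)%Z. split; [lia|split].
  - rewrite Hs, <- Hz by lia. f_equal. lia.
  - intros j Hj. rewrite Hs, <- (Hg j Hj) by lia. f_equal. lia.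
Qed.

(** The point of this form is that [m] depends neither on the point nor on the zero. *)
Lemma orbit_closure_before_zero J n :
  exists m, forall x s, orbit_closure x -> x s 0 = true ->
    (forall i, 0 < i <= m -> x (s - Z.of_nat i)%Z 0 = false) ->
    forall j, 0 < j <= J -> x (s - Z.of_nat j)%Z n = false.
Proof.
  exists (2 ^ (J + n + 1)). intros x s Hx Hs Hm j Hj.
  destruct (orbit_closure_window x
    (Z.abs s + Z.of_nat J + Z.of_nat (2 ^ (J + n + 1))) n Hx) as [r Hr].
  assert (HJ : J < 2 ^ J) by (apply Nat.pow_gt_lin_r; lia).
  rewrite Hr, <- (base_before_zero (r + s) (2 ^ (J + n + 1)) (J + n + 1) J j n);
    [f_equal; lia| | |lia..].
  - rewrite <- Hr by lia. trivial.
  - intros i Hi. rewrite <- Z.add_sub_assoc, <- Hr by lia. auto.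
Qed.

(** * Tails and the absence of asymptotic pairs *)

Definition tail (x : point) (t : Z) (n : nat) : Prop :=
  forall j m, x (t + Z.of_nat j)%Z m = (n + popcount j =? m).

(** A gap longer than [2 * j] has its cutoff beyond [j], so the label at distance [j] is the digit
    sum. *)
Lemma tail_after_last_zero x s :
  orbit_closure x -> x s 0 = true -> (forall t, (s < t)%Z -> x t 0 = false) -> tail x s 0.
Proof.
  intros Hx Hs Hz j n.
  destruct (orbit_closure_window x (Z.abs s + 2 * Z.of_nat j) n Hx) as [r Hr].
  rewrite Hr, Z.add_assoc by lia. apply base_after_zero with (m := 2 * j); [| |lia].
  - rewrite <- Hr by lia. trivial.
  - intros i Hi. rewrite <- Z.add_assoc, <- Hr by lia. apply Hz. lia.
Qed.

(** As [n] is the least label of [x] and there are no zeros, [base_around_minimum] applies to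
    windows of every size [e]. *)
Lemma tail_of_minimum x t n :
  orbit_closure x -> (forall s, x s 0 = false) -> x t n = true ->
  (forall s m, m < n -> x s m = false) ->
  tail x t n /\ forall j m, 0 < j -> x (t - Z.of_nat j)%Z m = false.
Proof.
  intros Hx Hz Ht Hmin.
  assert (W : forall e k, exists s,
    (forall i m, (Z.abs i <= 2 ^ Z.of_nat (S e))%Z -> m <= n + k ->
      x (t + i)%Z m = base (s + i) m)).
  { intros e k. destruct (orbit_closure_window x
      (Z.abs t + 2 ^ Z.of_nat (S e)) (n + k) Hx) as [s Hs].
    exists (s + t)%Z. intros i m Hi Hm. rewrite Hs by lia. f_equal. lia. }
  assert (M : forall e k, n < e -> exists s,
    (forall i m, (Z.abs i <= 2 ^ Z.of_nat (S e))%Z -> m <= n + k ->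
      x (t + i)%Z m = base (s + i) m) /\
    (forall j m, j < 2 ^ e -> base (s + Z.of_nat j) m = (n + popcount j =? m)) /\
    (forall f j m, f <= e -> 0 < j <= 2 ^ f -> m < e - f -> base (s - Z.of_nat j) m = false)).
  { intros e k He. destruct (W e k) as [s Hs]. exists s. split; [trivial|].
    assert (0 <= 2 ^ Z.of_nat (S e))%Z by (apply Z.pow_nonneg; lia).
    apply base_around_minimum; trivial.
    - replace s with (s + 0)%Z by lia. rewrite <- Hs, Z.add_0_r by lia. trivial.
    - intros i Hi. rewrite <- Hs by lia. apply Hz.
    - intros i m Hi Hm. rewrite <- Hs by lia. now apply Hmin. }
  split.
  - intros j m. assert (Hj : j < 2 ^ j) by (apply Nat.pow_gt_lin_r; lia).
    destruct (M (n + j + 1) m ltac:(lia)) as (s & Hs & H & _).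
    assert (2 ^ j <= 2 ^ (n + j + 1)) by (apply Nat.pow_le_mono_r; lia).
    assert (2 ^ Z.of_nat (S (n + j + 1)) = 2 * Z.of_nat (2 ^ (n + j + 1)))%Z as E.
    { rewrite Nat2Z.inj_succ, Z.pow_succ_r, Nat2Z.inj_pow by lia. reflexivity. }
    rewrite Hs by lia. apply H. lia.
  - intros j m Hj. assert (Hj2 : j < 2 ^ j) by (apply Nat.pow_gt_lin_r; lia).
    destruct (M (n + m + j + 1) m ltac:(lia)) as (s & Hs & _ & H).
    assert (2 ^ j <= 2 ^ (n + m + j + 1)) by (apply Nat.pow_le_mono_r; lia).
    assert (2 ^ Z.of_nat (S (n + m + j + 1)) = 2 * Z.of_nat (2 ^ (n + m + j + 1)))%Z as E.
    { rewrite Nat2Z.inj_succ, Z.pow_succ_r, Nat2Z.inj_pow by lia. reflexivity. }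
    rewrite <- Z.add_opp_r, Hs, Z.add_opp_r by lia.
    apply (H j); lia.
Qed.

Lemma orbit_closure_high K n :
  exists L, forall x r, orbit_closure x -> exists i, (0 <= i <= Z.of_nat L)%Z /\
    forall t m, (Z.abs t <= Z.of_nat K)%Z -> m <= n -> x (r + i + t)%Z m = false.
Proof.
  (* The window of 2K + 1 times has to fit into the [2 ^ f] times with large labels. *)
  set (f := 2 * K + 1).
  destruct (base_high_syndetic (f + n + 1) f ltac:(lia)) as [L HL].
  exists L. intros x r Hx.
  destruct (orbit_closure_window x (Z.abs r + Z.of_nat L + Z.of_nat K) n Hx) as [s Hs].
  destruct (HL (s + r + Z.of_nat K + 1)%Z) as (i & Hi & H).
  assert (Hf : f < 2 ^ f) by (apply Nat.pow_gt_lin_r; lia).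
  exists i. split; [trivial|]. intros t m Ht Hm.
  rewrite Hs, <- (H (Z.to_nat (Z.of_nat K + 1 - t)) m) by lia. f_equal. lia.
Qed.

Lemma last_zero (x : point) z b :
  x z 0 = true -> (forall t, (b <= t)%Z -> x t 0 = false) ->
  exists t, (z <= t < b)%Z /\ x t 0 = true /\ forall s, (t < s)%Z -> x s 0 = false.
Proof.
  intros Hz Hb.
  assert (H : forall k, (forall t, (z + Z.of_nat k < t)%Z -> x t 0 = false) ->
    exists t, (z <= t)%Z /\ x t 0 = true /\ forall s, (t < s)%Z -> x s 0 = false).
  { induction k as [|k IH]; intros Hk.
    - exists z. repeat split; [lia|trivial|]. intros s Hs. apply Hk. lia.
    - destruct (x (z + Z.of_nat (S k))%Z 0) eqn:E.
      + exists (z + Z.of_nat (S k))%Z. repeat split; trivial. lia.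
      + apply IH. intros s Hs.
        destruct (Z.eq_dec s (z + Z.of_nat (S k))) as [->|]; [trivial|apply Hk; lia]. }
  destruct (H (Z.to_nat (b - z))) as (t & Hzt & Ht & Hs).
  { intros t Ht. apply Hb. lia. }
  exists t. repeat split; trivial. apply Z.nle_gt. intros Hbt. rewrite Hb in Ht; easy.
Qed.

Lemma equal_of_common_zeros x y a z :
  orbit_closure x -> orbit_closure y ->
  (forall t, (a <= t)%Z -> x t 0 = y t 0) -> (a <= z)%Z -> x z 0 = true ->
  forall t n, x t n = y t n.
Proof.
  intros Hx Hy Hxy Haz Hz.
  assert (Hleft : forall z, (a <= z)%Z -> x z 0 = true ->
            forall t n, (t <= z)%Z -> x t n = y t n).
  { clear z Haz Hz. intros z Haz Hz t n Htz.
    (* The first block end at or after [z] with a gap longer than [m] is a zero of both points. Its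
       block begins at some [s] not after [z], equals the prefix of [base] in both points, and is
       preceded by [m] times without zeros. *)
    assert (Hblock : forall m, exists s,
      ((s <= z)%Z /\ (forall t n, (s <= t <= z)%Z -> x t n = y t n)) /\
      x s 0 = true /\ y s 0 = true /\
      (forall i, 0 < i <= m -> x (s - Z.of_nat i)%Z 0 = false) /\
      (forall i, 0 < i <= m -> y (s - Z.of_nat i)%Z 0 = false)).
    { intros m. destruct (orbit_closure_next_block_end x z m Hx Hz) as (q & Hq & Hq0 & Hqm).
      destruct (orbit_closure_block_end x q m Hx Hq0 Hqm) as [Bx Gx].
      destruct (orbit_closure_block_end y q m Hy) as [By Gy].
      { rewrite <- Hxy by lia. trivial. }
      { intros i Hi. rewrite <- Hxy by lia. auto. }
      exists (q - Z.of_nat (block_length m))%Z. repeat split; trivial.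
      - lia.
      - intros t' n' Ht'.
        replace t' with (q - Z.of_nat (block_length m) +
          Z.of_nat (Z.to_nat (t' - (q - Z.of_nat (block_length m)))))%Z by lia.
        rewrite Bx, By by lia. reflexivity.
      - rewrite <- (Z.add_0_r (_ - _)). change 0%Z with (Z.of_nat 0).
        rewrite Bx by lia. apply (base_zero_pos 0).
      - rewrite <- (Z.add_0_r (_ - _)). change 0%Z with (Z.of_nat 0).
        rewrite By by lia. apply (base_zero_pos 0). }
    (* If [t] comes before the block, it is at most [z - t] steps before [s], so both labels there
       exceed [n]. *)
    destruct (orbit_closure_before_zero (Z.to_nat (z - t)) n) as [m Hm].
    destruct (Hblock m) as (s & [Hsz Heq] & Hx0 & Hy0 & Hxm & Hym).
    destruct (Z.le_gt_cases s t) as [Hst|Hst]; [apply Heq; lia|].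
    replace t with (s - Z.of_nat (Z.to_nat (s - t)))%Z by lia.
    rewrite (Hm x s), (Hm y s); trivial; lia. }
  intros t n. destruct (Z.le_gt_cases t z) as [Htz|Htz]; [now apply (Hleft z)|].
  destruct (classic (exists z', (t <= z')%Z /\ x z' 0 = true)) as [(z' & Hz' & H)|H].
  - apply (Hleft z'); trivial. lia.
  - destruct (last_zero x z t) as (z' & Hz' & H0 & H1); trivial.
    { intros s Hs. apply Bool.not_true_is_false. intros E. apply H. eauto. }
    assert (Tx : tail x z' 0) by now apply tail_after_last_zero.
    assert (Ty : tail y z' 0).
    { apply tail_after_last_zero; trivial.
      - rewrite <- Hxy by lia. trivial.
      - intros s Hs. rewrite <- Hxy by lia. auto. }
    replace t with (z' + Z.of_nat (Z.to_nat (t - z')))%Z by lia.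
    now rewrite Tx, Ty.
Qed.

Definition eventually_agree (x y : point) : Prop :=
  forall n, exists a, forall t, (a <= t)%Z -> x t n = y t n.

Lemma eventually_agree_sym x y : eventually_agree x y -> eventually_agree y x.
Proof. intros H n. destruct (H n) as [a Ha]. exists a. intros t Ht. symmetry. auto. Qed.

(* The tails are compared at times [s + 2^k] if [n <= m], and [t + 2^k] otherwise. *)
Lemma tail_unique_le x y s t n m :
  tail x s n -> tail y t m -> eventually_agree x y -> (t <= s)%Z -> s = t /\ n = m.
Proof.
  intros Hx Hy Hxy Hst.
  set (c := Z.to_nat (s - t)).
  assert (Hy' : forall j l, y (s + Z.of_nat j)%Z l = (m + popcount (c + j) =? l)).
  { intros j l. rewrite <- Hy. f_equal. lia. }
  assert (Hk : forall a, exists k, c < 2 ^ k /\ (a <= s + Z.of_nat (2 ^ k - c))%Z).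
  { intros a. exists (c + Z.to_nat (a - s)).
    assert (c + Z.to_nat (a - s) < 2 ^ (c + Z.to_nat (a - s))) by (apply Nat.pow_gt_lin_r; lia).
    lia. }
  destruct (Nat.le_gt_cases n m) as [Hnm|Hnm].
  - destruct (Hxy (n + 1)) as [a Ha]. destruct (Hk a) as (k & Hk1 & Hk2).
    specialize (Ha (s + Z.of_nat (2 ^ k))%Z ltac:(lia)).
    rewrite Hx, Hy', popcount_pow2, Nat.eqb_refl in Ha.
    symmetry in Ha. apply Nat.eqb_eq in Ha.
    replace (c + 2 ^ k) with (1 * 2 ^ k + c) in Ha by lia.
    rewrite popcount_concat in Ha by trivial. change (popcount 1) with 1 in Ha.
    destruct (Nat.eq_dec c 0) as [Hc|Hc]; [lia|].
    assert (H := popcount_pos c ltac:(lia)). lia.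
  - destruct (Hxy (m + 1)) as [a Ha]. destruct (Hk a) as (k & Hk1 & Hk2).
    specialize (Ha (s + Z.of_nat (2 ^ k - c))%Z ltac:(lia)).
    rewrite Hx, Hy' in Ha. replace (c + (2 ^ k - c)) with (2 ^ k) in Ha by lia.
    rewrite popcount_pow2, Nat.eqb_refl in Ha. apply Nat.eqb_eq in Ha.
    assert (H := popcount_pos (2 ^ k - c) ltac:(lia)). lia.
Qed.

Lemma tail_unique x y s t n m :
  tail x s n -> tail y t m -> eventually_agree x y -> s = t /\ n = m.
Proof.
  intros Hx Hy Hxy. destruct (Z.le_ge_cases t s) as [H|H].
  - now apply (tail_unique_le x y).
  - apply eventually_agree_sym in Hxy.
    destruct (tail_unique_le y x t s m n) as [-> ->]; auto.
Qed.

(** The label n + 1 occurs at all times [s] plus a power of two. *)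
Lemma tail_not_eventually_high x y s n :
  tail x s n -> (forall t m, y t m = false) -> ~ eventually_agree x y.
Proof.
  intros Hx Hy Hxy. destruct (Hxy (n + 1)) as [a Ha].
  assert (Z.to_nat (a - s) < 2 ^ Z.to_nat (a - s)) by (apply Nat.pow_gt_lin_r; lia).
  specialize (Ha (s + Z.of_nat (2 ^ Z.to_nat (a - s)))%Z ltac:(lia)).
  rewrite Hx, Hy, popcount_pow2, Nat.eqb_refl in Ha. easy.
Qed.

Lemma no_eventual_zero_cases x a :
  orbit_closure x -> (forall t, (a <= t)%Z -> x t 0 = false) ->
  (forall t n, x t n = false) \/
  exists t n, tail x t n /\
    (n = 0 \/ forall j m, 0 < j -> x (t - Z.of_nat j)%Z m = false).
Proof.
  intros Hx Ha.
  destruct (classic (exists t, x t 0 = true)) as [[z Hz]|Hz].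
  - right.
    destruct (last_zero x z a Hz Ha) as (t & _ & Ht & Hs).
    exists t, 0. split; [now apply tail_after_last_zero|now left].
  - assert (Hz' : forall t, x t 0 = false).
    { intros t. apply Bool.not_true_is_false. intros E. apply Hz. eauto. }
    destruct (classic (exists n t, x t n = true)) as [[n Hn]|Hn].
    + right. revert Hn. induction n as [n IH] using lt_wf_ind. intros [t Ht].
      destruct (classic (exists m, m < n /\ exists t, x t m = true)) as [(m & Hm & H)|H].
      * now apply (IH m).
      * destruct (tail_of_minimum x t n) as [T L]; trivial.
        { intros s m Hm. apply Bool.not_true_is_false. intros E. apply H. eauto. }
        exists t, n. split; [trivial|now right].
    + left. intros t n. apply Bool.not_true_is_false. intros E. apply Hn. eauto.
Qed.

Lemma no_asymptotic x y :
  orbit_closure x -> orbit_closure y -> eventually_agree x y -> forall t n, x t n = y t n.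
Proof.
  intros Hx Hy Hxy. destruct (Hxy 0) as [a Ha].
  destruct (classic (exists z, (a <= z)%Z /\ x z 0 = true)) as [(z & Haz & Hz)|Hz].
  { now apply (equal_of_common_zeros x y a z). }
  assert (Hx0 : forall t, (a <= t)%Z -> x t 0 = false).
  { intros t Ht. apply Bool.not_true_is_false. intros E. apply Hz. eauto. }
  destruct (no_eventual_zero_cases x a Hx Hx0) as [Px|(s & n & Tx & Lx)];
    destruct (no_eventual_zero_cases y a Hy) as [Py|(s' & n' & Ty & Ly)];
    try (intros t Ht; rewrite <- Ha; now auto).
  - intros t n. now rewrite Px, Py.
  - exfalso. apply eventually_agree_sym in Hxy. now apply (tail_not_eventually_high y x s' n').
  - exfalso. now apply (tail_not_eventually_high x y s n).
  - destruct (tail_unique x y s s' n n') as [<- <-]; trivial.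
    assert (Hr : forall t m, (s <= t)%Z -> x t m = y t m).
    { intros t m Ht. replace t with (s + Z.of_nat (Z.to_nat (t - s)))%Z by lia.
      now rewrite Tx, Ty. }
    (* The points agree from [s] on. For [n = 0] the time [s] is a common zero; for [n > 0] both
       points are infinite before [s]. *)
    destruct (Nat.eq_dec n 0) as [->|Hn].
    + apply (equal_of_common_zeros x y s s); trivial; [auto|lia|].
      replace s with (s + Z.of_nat 0)%Z by lia. now rewrite Tx.
    + destruct Lx as [|Lx], Ly as [|Ly]; try easy.
      intros t m. destruct (Z.le_gt_cases s t) as [|Ht]; [auto|].
      replace t with (s - Z.of_nat (Z.to_nat (s - t)))%Z by lia.
      rewrite Lx, Ly by lia. reflexivity.
Qed.

(** * Closedness, perfectness, mixing and proximality of the orbit closure *)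

Definition infinity : point := fun _ _ => false.

Lemma orbit_closure_closed x :
  (forall N, exists y, orbit_closure y /\ agree N x y) -> orbit_closure x.
Proof.
  intros H N. destruct (H N) as (y & Hy & Hxy). destruct (Hy N) as [s Hs].
  exists s. intros t n Ht Hn. rewrite Hxy, Hs; trivial.
Qed.

Lemma orbit_closure_infinity : orbit_closure infinity.
Proof.
  intros N. destruct (orbit_closure_high N N) as [L HL].
  destruct (HL base 0%Z) as (i & _ & Hi).
  { intros M. exists 0%Z. intros t n _ _. reflexivity. }
  exists i. intros t n Ht Hn. unfold infinity, shift. rewrite <- (Hi t n Ht Hn). f_equal.
Qed.

Lemma base_0 : base 0 0 = true.
Proof. apply (base_zero_pos 0). Qed.

(** By recurrence two different shifts of [base] are close to [x]: at time [- s - p] one has its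
    first zero and the other is infinite. At least one of them differs from [x]. *)
Lemma orbit_closure_perfect x N :
  orbit_closure x -> exists y, orbit_closure y /\ agree N x y /\ exists t n, x t n <> y t n.
Proof.
  intros Hx. destruct (Hx N) as [s Hs].
  destruct (base_recurrence N s) as [e He]. specialize (He 1).
  set (p := Z.of_nat (zero_pos (1 * 2 ^ e))) in *.
  assert (Hp : (0 < p)%Z).
  { unfold p, zero_pos. rewrite popcount_shift. change (popcount 1) with 1.
    assert (H := pow2_pos e). lia. }
  assert (E : shift s base (- s - p)%Z 0 <> shift (p + s) base (- s - p)%Z 0).
  { unfold shift. replace (p + s + (- s - p))%Z with 0%Z by lia.
    rewrite base_0, base_neg by lia. easy. }
  destruct (Bool.bool_dec (x (- s - p)%Z 0) (shift s base (- s - p)%Z 0)) as [Ex|Ex].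
  - exists (shift (p + s) base). split; [apply orbit_closure_shift_base|split].
    + intros t n Ht Hn. rewrite He, Hs; trivial.
    + exists (- s - p)%Z, 0. congruence.
  - exists (shift s base). split; [apply orbit_closure_shift_base|split]; eauto.
Qed.

(** The digit sum falls from [g] to 1 between the two indices, so varying [g] realizes every
    sufficiently large distance between two recurrences of a block. *)
Lemma zero_pos_pow2_difference e g :
  zero_pos (2 ^ g * 2 ^ e) = zero_pos ((2 ^ g - 1) * 2 ^ e) + 2 ^ S e + g - 1.
Proof.
  unfold zero_pos. rewrite !popcount_shift, popcount_pow2, popcount_ones, Nat.pow_succ_r'.
  assert (H1 := pow2_pos e).
  assert (H2 : g < 2 ^ g) by (apply Nat.pow_gt_lin_r; lia).
  nia.
Qed.

Lemma orbit_closure_mixing x y N :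
  orbit_closure x -> orbit_closure y ->
  exists M, forall k, M <= k ->
    exists w, orbit_closure w /\ agree N x w /\ agree N y (shift (Z.of_nat k) w).
Proof.
  intros Hx Hy. destruct (Hx N) as [s Hs], (Hy N) as [r Hr].
  destruct (base_recurrence N s) as [e He], (base_recurrence N r) as [e' He'].
  (* At zeros whose index is a multiple of [2 ^ d] both patterns recur. *)
  set (d := e + e').
  exists (2 ^ S d + Z.to_nat (Z.abs r) + Z.to_nat (Z.abs s)). intros k Hk.
  destruct (Z_of_nat_complete (Z.of_nat k - Z.of_nat (2 ^ S d) + 1 - r + s)) as [g Hg]; [lia|].
  assert (E := zero_pos_pow2_difference d g).
  assert (Hp := pow2_pos d). rewrite Nat.pow_succ_r' in *.
  specialize (He ((2 ^ g - 1) * 2 ^ e')). specialize (He' (2 ^ g * 2 ^ e)).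
  replace ((2 ^ g - 1) * 2 ^ e' * 2 ^ e) with ((2 ^ g - 1) * 2 ^ d) in He
    by (unfold d; now rewrite <- Nat.mul_assoc, <- Nat.pow_add_r, (Nat.add_comm e e')).
  replace (2 ^ g * 2 ^ e * 2 ^ e') with (2 ^ g * 2 ^ d) in He'
    by (unfold d; rewrite Nat.pow_add_r; apply Nat.mul_assoc).
  exists (shift (Z.of_nat (zero_pos ((2 ^ g - 1) * 2 ^ d)) + s) base).
  split; [apply orbit_closure_shift_base|split]; intros t n Ht Hn.
  - now rewrite He, Hs.
  - rewrite Hr, <- He' by trivial. unfold shift. f_equal. lia.
Qed.

(** First a time is found where [x] is high on a window with margin [L]; within the next [L] steps
    [y] is high too, while [x] still is. *)
Lemma orbit_closure_proximal x y N M :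
  orbit_closure x -> orbit_closure y ->
  exists k, M <= k /\ agree N (shift (Z.of_nat k) x) infinity /\
    agree N (shift (Z.of_nat k) y) infinity.
Proof.
  intros Hx Hy. destruct (orbit_closure_high N N) as [L HL].
  destruct (orbit_closure_high (L + N) N) as [L' HL'].
  destruct (HL' x (Z.of_nat M) Hx) as (i & Hi & Hix).
  destruct (HL y (Z.of_nat M + i)%Z Hy) as (j & Hj & Hjy).
  exists (M + Z.to_nat i + Z.to_nat j). split; [lia|].
  split; intros t n Ht Hn; unfold shift, infinity.
  - rewrite <- (Hix (j + t)%Z n) by lia. f_equal. lia.
  - rewrite <- (Hjy t n) by lia. f_equal. lia.
Qed.

(** * Perfect sets of bit sequences *)

Definition prefix_eq (n : nat) (u v : Cantor) : Prop := forall i, i < n -> u i = v i.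

Definition branches (Q : Cantor -> Prop) (u : Cantor) (n : nat) : Prop :=
  exists v w, Q v /\ Q w /\ prefix_eq n u v /\ prefix_eq n u w /\ v n <> w n.

Fixpoint branch_count (Q : Cantor -> Prop) (u : Cantor) (n : nat) : nat :=
  match n with
  | 0 => 0
  | S n => (if excluded_middle_informative (branches Q u n) then 1 else 0) + branch_count Q u n
  end.

(* [u] is encoded by the bits it takes at the levels where the tree of prefixes of [Q] branches. *)
Definition follows (Q : Cantor -> Prop) (c u : Cantor) : Prop :=
  forall n, branches Q u n -> u n = c (branch_count Q u n).

Lemma prefix_eq_sym n u v : prefix_eq n u v -> prefix_eq n v u.
Proof. intros H i Hi. symmetry. auto. Qed.

Lemma prefix_eq_trans n u v w : prefix_eq n u v -> prefix_eq n v w -> prefix_eq n u w.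
Proof. intros H1 H2 i Hi. rewrite H1; auto. Qed.

Lemma prefix_eq_le m n u v : m <= n -> prefix_eq n u v -> prefix_eq m u v.
Proof. intros H1 H2 i Hi. apply H2. lia. Qed.

Lemma prefix_eq_S n u v : prefix_eq n u v -> u n = v n -> prefix_eq (S n) u v.
Proof.
  intros H E i Hi. destruct (Nat.eq_dec i n) as [->|]; [trivial|]. apply H. lia.
Qed.

Lemma branches_prefix Q n u v : prefix_eq n u v -> branches Q u n -> branches Q v n.
Proof.
  intros H (w & w' & Qw & Qw' & E & E' & D). exists w, w'.
  apply prefix_eq_sym in H. repeat split; eauto using prefix_eq_trans.
Qed.

Lemma branch_count_prefix Q n u v :
  prefix_eq n u v -> branch_count Q u n = branch_count Q v n.
Proof.
  induction n as [|n IH]; intros H; [reflexivity|].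
  assert (H' : prefix_eq n u v) by (apply (prefix_eq_le n (S n)); auto).
  simpl. rewrite (IH H').
  destruct excluded_middle_informative as [B|B], excluded_middle_informative as [B'|B'];
    try reflexivity; exfalso; eauto using branches_prefix, prefix_eq_sym.
Qed.

Lemma branch_count_le Q u n : branch_count Q u n <= n.
Proof. induction n; simpl; [lia|]. destruct excluded_middle_informative; lia. Qed.

Lemma branch_count_inj Q u m n :
  branches Q u m -> branches Q u n -> branch_count Q u m = branch_count Q u n -> m = n.
Proof.
  assert (H : forall m n, branches Q u m -> m < n -> branch_count Q u m < branch_count Q u n).
  { intros k l Hk. induction 1 as [|l Hl IH]; simpl.
    - destruct excluded_middle_informative; [lia|easy].
    - lia. }
  intros Hm Hn E. destruct (Nat.lt_trichotomy m n) as [L|[L|L]]; [|trivial|];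
    apply H in L; trivial; lia.
Qed.

Definition perfect (Q : Cantor -> Prop) : Prop :=
  forall u n, Q u -> exists v, Q v /\ prefix_eq n u v /\ exists i, u i <> v i.

Definition prefix_closed (Q : Cantor -> Prop) : Prop :=
  forall u, (forall n, exists v, Q v /\ prefix_eq n u v) -> Q u.

(** The first difference between [u] and another element of [Q] sharing [m] bits is a branching
    level. The least branching level from [m] on has no branching between, so the count is
    unchanged. *)
Lemma next_branch Q u m :
  perfect Q -> Q u ->
  exists n, branches Q u n /\ branch_count Q u n = branch_count Q u m.
Proof.
  intros HQ Qu. destruct (HQ u m Qu) as (v & Qv & Hm & [i Hi]).
  assert (H : exists n, m <= n /\ branches Q u n).
  { revert Hi. induction i as [i IH] using lt_wf_ind. intros Hi.
    destruct (classic (exists j, j < i /\ u j <> v j)) as [(j & Hj & E)|H].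
    - now apply (IH j).
    - exists i. split.
      + destruct (Nat.le_gt_cases m i); [trivial|]. exfalso. auto.
      + exists u, v. repeat split; trivial.
        intros j Hj. apply NNPP. intros E. apply H. eauto. }
  destruct H as [n Hn]. revert Hn. induction n as [n IH] using lt_wf_ind. intros [Hmn Hb].
  destruct (classic (exists k, k < n /\ m <= k /\ branches Q u k)) as [(k & Hk & H)|H].
  - now apply (IH k).
  - exists n. split; [trivial|]. clear - Hmn H. induction Hmn as [|n Hmn IH]; [trivial|].
    simpl. destruct excluded_middle_informative as [B|B].
    + exfalso. apply H. eauto.
    + apply IH. intros (k & Hk & H'). apply H. eauto.
Qed.

Lemma nth_branch Q u k :
  perfect Q -> Q u -> exists n, branches Q u n /\ branch_count Q u n = k.
Proof.
  intros HQ Qu. induction k as [|k (n & Hn & E)].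
  - apply (next_branch Q u 0 HQ Qu).
  - destruct (next_branch Q u (S n) HQ Qu) as (l & Hl & El).
    exists l. split; [trivial|]. rewrite El. simpl.
    destruct excluded_middle_informative; [lia|easy].
Qed.

(** Elements of [Q] obeying [c] on longer and longer prefixes are chosen successively; their limit
    is in [Q] by closedness. *)
Lemma follows_exists Q c :
  prefix_closed Q -> (exists u, Q u) -> exists u, Q u /\ follows Q c u.
Proof.
  intros HQ [u0 Qu0].
  set (good n u := Q u /\
    forall i, i < n -> branches Q u i -> u i = c (branch_count Q u i)).
  assert (step : forall n u, good n u -> exists v, good (S n) v /\ prefix_eq n u v).
  { intros n u [Qu Hu]. destruct (classic (branches Q u n)) as [B|B].
    - assert (exists v, Q v /\ prefix_eq n u v /\ v n = c (branch_count Q u n))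
        as (v & Qv & Huv & Hv).
      { destruct B as (v & w & Qv & Qw & Hv & Hw & D).
        destruct (Bool.bool_dec (v n) (c (branch_count Q u n))) as [E|E]; [eauto|].
        exists w. repeat split; trivial.
        destruct (v n), (w n), (c (branch_count Q u n)); easy. }
      exists v. split; [split; [trivial|]|trivial].
      intros i Hi Bi. destruct (Nat.eq_dec i n) as [->|].
      + now rewrite Hv, (branch_count_prefix Q n u v).
      + assert (Hi' : prefix_eq i u v) by (apply (prefix_eq_le i n); [lia|trivial]).
        rewrite <- (Huv i), <- (branch_count_prefix Q i u v) by (trivial; lia).
        apply Hu; [lia|]. apply (branches_prefix Q i v); [now apply prefix_eq_sym|trivial].
    - exists u. split; [split; [trivial|]|easy].
      intros i Hi Bi. apply Hu; [|trivial].
      destruct (Nat.eq_dec i n) as [->|]; [easy|lia]. }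
  destruct (choice (fun (p : nat * Cantor) v => good (fst p) (snd p) ->
    good (S (fst p)) v /\ prefix_eq (fst p) (snd p) v)) as [next Hnext].
  { intros [n u]. destruct (classic (good n u)) as [G|G].
    - destruct (step n u G) as [v Hv]. now exists v.
    (* An arbitrary value outside the domain of the choice. *)
    - now exists u. }
  set (a := fix a n := match n with 0 => u0 | S n => next (n, a n) end).
  assert (Ha : forall n, good n (a n)).
  { induction n as [|n IH]; [split; [trivial|lia]|]. apply (Hnext (n, a n) IH). }
  assert (HS : forall n, prefix_eq n (a n) (a (S n))).
  { intros n. apply (Hnext (n, a n) (Ha n)). }
  assert (Hle : forall n m, n <= m -> prefix_eq n (a n) (a m)).
  { intros n m. induction 1 as [|m Hm IH]; [easy|].
    apply prefix_eq_trans with (a m); [trivial|].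
    apply prefix_eq_le with m; trivial. }
  set (u n := a (S n) n).
  assert (Hu : forall n, prefix_eq n u (a n)).
  { intros n i Hi. unfold u. apply Hle; lia. }
  exists u. split.
  - apply HQ. intros n. exists (a n). split; [apply Ha|apply Hu].
  - intros n B. rewrite (Hu (S n)) by lia. destruct (Ha (S n)) as [_ H].
    assert (E : prefix_eq n u (a (S n))) by (apply prefix_eq_le with (S n); auto).
    rewrite (branch_count_prefix Q n u (a (S n)) E). apply H; [lia|].
    now apply (branches_prefix Q n u).
Qed.

(** At a branching level below [n] the bit read from the code has index at most that level; at any
    other level the prefix determines the bit. *)
Lemma follows_prefix Q n c c' u u' :
  Q u -> Q u' -> follows Q c u -> follows Q c' u' -> prefix_eq n c c' -> prefix_eq n u u'.
Proof.
  intros Qu Qu' Hu Hu' Hc.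
  assert (H : forall m, m <= n -> prefix_eq m u u').
  { induction m as [|m IH]; intros Hm; [intros i; lia|].
    specialize (IH ltac:(lia)). apply prefix_eq_S; [trivial|].
    destruct (classic (branches Q u m)) as [B|B].
    - rewrite Hu, Hu' by eauto using branches_prefix.
      rewrite (branch_count_prefix Q m u u' IH). apply Hc.
      assert (L := branch_count_le Q u' m). lia.
    - apply NNPP. intros D. apply B. exists u, u'. repeat split; trivial. }
  now apply H.
Qed.

Lemma follows_inverse Q u :
  perfect Q -> Q u -> exists c, follows Q c u.
Proof.
  intros HQ Qu.
  destruct (choice (fun k n => branches Q u n /\ branch_count Q u n = k)) as [f Hf].
  { intros k. now apply nth_branch. }
  exists (fun k => u (f k)). intros n B. f_equal.
  destruct (Hf (branch_count Q u n)) as [B' E]. now apply (branch_count_inj Q u).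
Qed.

(** It suffices that [N] exceeds the first [n] branching levels of [u]. With [u' = u] this also
    shows that the code is unique. *)
Lemma follows_inverse_prefix Q n u :
  perfect Q -> Q u ->
  exists N, forall c c' u', prefix_eq N u u' -> follows Q c u -> follows Q c' u' ->
    prefix_eq n c c'.
Proof.
  intros HQ Qu. induction n as [|n [N HN]].
  - exists 0. intros c c' u' _ _ _ i. lia.
  - destruct (nth_branch Q u n HQ Qu) as (m & B & E).
    exists (N + S m). intros c c' u' H Hc Hc'.
    assert (Hm : prefix_eq m u u') by (apply prefix_eq_le with (N + S m); [lia|trivial]).
    apply prefix_eq_S.
    + apply (HN c c' u'); trivial. apply prefix_eq_le with (N + S m); [lia|trivial].
    + rewrite <- E. rewrite <- Hc by trivial.
      rewrite (branch_count_prefix Q m u u' Hm), <- Hc' by now apply (branches_prefix Q m u).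
      apply H. lia.
Qed.

Lemma perfect_set_homeomorphic Q :
  prefix_closed Q -> perfect Q -> (exists u, Q u) ->
  exists h g : Cantor -> Cantor,
    (forall c, Q (h c)) /\ (forall c, g (h c) = c) /\ (forall u, Q u -> h (g u) = u) /\
    (forall n c c', prefix_eq n c c' -> prefix_eq n (h c) (h c')) /\
    (forall n u, Q u ->
       exists N, forall u', Q u' -> prefix_eq N u u' -> prefix_eq n (g u) (g u')).
Proof.
  intros Hcl Hpf Hne.
  destruct (choice (fun c u => Q u /\ follows Q c u)) as [h Hh].
  { intros c. now apply follows_exists. }
  destruct (choice (fun u c => Q u -> follows Q c u)) as [g Hg].
  { intros u. destruct (classic (Q u)) as [Qu|Qu].
    - destruct (follows_inverse Q u Hpf Qu) as [c Hc]. now exists c.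
    - now exists u. }
  exists h, g. split; [|split; [|split; [|split]]].
  - apply Hh.
  - intros c. apply functional_extensionality. intros n. destruct (Hh c) as [Qc Fc].
    destruct (follows_inverse_prefix Q (S n) (h c) Hpf Qc) as [N HN].
    apply (HN (g (h c)) c (h c)); auto. easy.
  - intros u Qu. apply functional_extensionality. intros n. destruct (Hh (g u)) as [Qc Fc].
    apply (follows_prefix Q (S n) (g u) (g u)); auto. easy.
  - intros n c c' H. destruct (Hh c), (Hh c'). now apply (follows_prefix Q n c c').
  - intros n u Qu. destruct (follows_inverse_prefix Q n u Hpf Qu) as [N HN].
    exists N. intros u' Qu' H. apply (HN _ _ u'); auto.
Qed.
(** * Transfer to the metric Cantor set *)

(** An integer is stored as the pair of its positive and negative parts, so not every index is a
    code. *)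
Definition code (t : Z) (n : nat) : nat :=
  Cantor.to_nat (Cantor.to_nat (Z.to_nat t, Z.to_nat (- t)), n).

Definition coord (i : nat) : Z * nat :=
  let (a, n) := Cantor.of_nat i in
  let (b, c) := Cantor.of_nat a in (Z.of_nat b - Z.of_nat c, n)%Z.

Lemma coord_code t n : coord (code t n) = (t, n).
Proof. unfold coord, code. rewrite !Cantor.cancel_of_to. f_equal. lia. Qed.

Lemma code_bound N :
  exists M, forall t n, (Z.abs t <= Z.of_nat N)%Z -> n <= N -> code t n < M.
Proof.
  assert (H : forall x y b, x <= b -> y <= b -> Cantor.to_nat (x, y) <= (2 * b + 1) * (2 * b + 1)).
  { intros x y b Hx Hy. assert (E := Cantor.to_nat_spec x y).
    assert ((y + x) * S (y + x) <= (2 * b) * S (2 * b)) by (apply Nat.mul_le_mono; lia). lia. }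
  set (b := (2 * N + 1) * (2 * N + 1)).
  exists (S ((2 * b + 1) * (2 * b + 1))). intros t n Ht Hn.
  apply le_n_S, H; [apply H; lia|unfold b; lia].
Qed.

Definition bits (x : point) : Cantor := fun i => x (fst (coord i)) (snd (coord i)).
Definition unbits (u : Cantor) : point := fun t n => u (code t n).

Lemma unbits_bits x : unbits (bits x) = x.
Proof.
  apply functional_extensionality; intros t. apply functional_extensionality; intros n.
  unfold unbits, bits. now rewrite coord_code.
Qed.

Lemma agree_unbits N : exists M, forall u v, prefix_eq M u v -> agree N (unbits u) (unbits v).
Proof.
  destruct (code_bound N) as [M HM]. exists M. intros u v H t n Ht Hn.
  apply H. now apply HM.
Qed.

Lemma prefix_eq_bits n : exists N, forall x y, agree N x y -> prefix_eq n (bits x) (bits y).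
Proof.
  induction n as [|n [N HN]].
  - exists 0. intros x y _ i Hi. lia.
  - exists (N + Z.to_nat (Z.abs (fst (coord n))) + snd (coord n)). intros x y H.
    apply prefix_eq_S.
    + apply HN. intros t m Ht Hm. apply H; lia.
    + apply H; lia.
Qed.

Lemma agree_le M N x y : M <= N -> agree N x y -> agree M x y.
Proof. intros HMN H t n Ht Hn. apply H; lia. Qed.

Lemma orbit_closure_homeomorphic :
  exists (H : Cantor -> point) (G : point -> Cantor),
    (forall c, orbit_closure (H c)) /\ (forall c, G (H c) = c) /\
    (forall x, orbit_closure x -> H (G x) = x) /\
    (forall N, exists n, forall c c', prefix_eq n c c' -> agree N (H c) (H c')) /\
    (forall n x, orbit_closure x ->
       exists N, forall y, orbit_closure y -> agree N x y -> prefix_eq n (G x) (G y)).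
Proof.
  (* The second condition fixes the bits at indices that are not codes. *)
  set (Q u := orbit_closure (unbits u) /\ bits (unbits u) = u).
  assert (QB : forall x, orbit_closure x -> Q (bits x)).
  { intros x Hx. unfold Q. now rewrite unbits_bits. }
  destruct (perfect_set_homeomorphic Q) as (h & g & Hh & Hgh & Hhg & Ch & Cg).
  - intros u Hu. split.
    + apply orbit_closure_closed. intros N. destruct (agree_unbits N) as [M HM].
      destruct (Hu M) as (v & [Hv _] & Huv). eauto.
    + apply functional_extensionality. intros i.
      set (j := code (fst (coord i)) (snd (coord i))).
      destruct (Hu (S (i + j))) as (v & [_ Hv] & Huv).
      change (u j = u i). rewrite !Huv by lia. exact (f_equal (fun w => w i) Hv).
  - intros u n [Hu Eu]. destruct (prefix_eq_bits n) as [N HN].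
    destruct (orbit_closure_perfect (unbits u) N Hu) as (y & Hy & Hxy & t & m & D).
    exists (bits y). split; [auto|split].
    + rewrite <- Eu. auto.
    + exists (code t m). unfold bits. rewrite coord_code. exact D.
  - exists (bits infinity). apply QB, orbit_closure_infinity.
  - exists (fun c => unbits (h c)), (fun x => g (bits x)).
    split; [|split; [|split; [|split]]].
    + apply Hh.
    + intros c. destruct (Hh c) as [_ ->]. apply Hgh.
    + intros x Hx. rewrite Hhg by auto. apply unbits_bits.
    + intros N. destruct (agree_unbits N) as [M HM]. exists M. auto.
    + intros n x Hx. destruct (Cg n (bits x) (QB x Hx)) as [M HM].
      destruct (prefix_eq_bits M) as [N HN]. exists N. intros y Hy Hxy. apply HM; auto.
Qed.

(** * The metric topology in terms of prefixes *)

Local Open Scope R_scope.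

Lemma cantor_partial_growing x y : Un_growing (cantor_partial x y).
Proof.
  intros n. unfold cantor_partial. cbn [sum_f_R0].
  assert (0 < 2 ^ S (S n)) by (apply pow_lt; lra).
  assert (0 <= bdiff (x (S n)) (y (S n)) / 2 ^ S (S n)); [|lra].
  apply Rmult_le_pos; [unfold bdiff; destruct Bool.eqb; lra|].
  apply Rlt_le, Rinv_0_lt_compat. trivial.
Qed.

Lemma cantor_partial_prefix x y n N :
  prefix_eq n x y -> cantor_partial x y N <= (/ 2) ^ n.
Proof.
  intros H.
  assert (Hn : forall k, (k < n)%nat -> bdiff (x k) (y k) = 0).
  { intros k Hk. unfold bdiff. now rewrite H, Bool.eqb_reflx. }
  assert (H0 : forall k, 0 < (/ 2) ^ k) by (intros k; apply pow_lt; lra).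
  (* The claim is strengthened to the exact value of the geometric sum from [n] to [N], so that the
     induction goes through. *)
  assert (HN : ((N < n)%nat -> cantor_partial x y N = 0) /\
               ((n <= N)%nat -> cantor_partial x y N <= (/ 2) ^ n - (/ 2) ^ S N)).
  { assert (T : forall k, bdiff (x k) (y k) / 2 ^ S k <= (/ 2) ^ S k).
    { intros k. unfold Rdiv. rewrite <- pow_inv. specialize (H0 (S k)).
      unfold bdiff. destruct Bool.eqb; lra. }
    induction N as [|N [IH1 IH2]]; unfold cantor_partial in *; cbn [sum_f_R0]; split; intros HN.
    - rewrite Hn by lia. lra.
    - specialize (T 0%nat). replace n with 0%nat by lia. simpl in *. lra.
    - rewrite IH1, Hn by lia. lra.
    - specialize (T (S N)).
      assert (E : (/ 2) ^ S N = 2 * (/ 2) ^ S (S N)) by (simpl; lra).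
      destruct (Nat.eq_dec n (S N)) as [->|Hne].
      + rewrite IH1 by lia. lra.
      + specialize (IH2 ltac:(lia)). lra. }
  destruct (Nat.lt_ge_cases N n) as [L|L].
  - rewrite (proj1 HN L). specialize (H0 n). lra.
  - specialize (proj2 HN L). specialize (H0 (S N)). lra.
Qed.

Lemma cantor_dist_cv x y : Un_cv (cantor_partial x y) (cantor_dist x y).
Proof.
  unfold cantor_dist. apply epsilon_spec.
  destruct (growing_cv (cantor_partial x y)) as [l Hl].
  - apply cantor_partial_growing.
  - exists 1. intros r [N ->]. apply (cantor_partial_prefix x y 0). intros i Hi. lia.
  - now exists l.
Qed.

Lemma cantor_dist_lt eps :
  0 < eps -> exists n, forall x y, prefix_eq n x y -> cantor_dist x y < eps.
Proof.
  intros He. destruct (pow_lt_1_zero (/ 2)) with (y := eps) as [n Hn]; trivial.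
  { rewrite Rabs_right; lra. }
  exists n. intros x y H.
  apply Rle_lt_trans with ((/ 2) ^ n).
  - apply Rle_cv_lim with (cantor_partial x y) (fun _ => (/ 2) ^ n).
    + intros N. now apply cantor_partial_prefix.
    + apply cantor_dist_cv.
    + intros e Hpos. exists 0%nat. intros. now rewrite Rdist_eq.
  - specialize (Hn n (le_n n)). rewrite Rabs_right in Hn; trivial.
    apply Rle_ge, pow_le. lra.
Qed.

(** A difference at some [i < n] alone contributes [(/ 2) ^ S i], which is at least [(/ 2) ^ n]. *)
Lemma cantor_dist_prefix n :
  exists eps, 0 < eps /\ forall x y, cantor_dist x y < eps -> prefix_eq n x y.
Proof.
  exists ((/ 2) ^ n). split; [apply pow_lt; lra|]. intros x y H i Hi.
  apply NNPP. intros D.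
  assert (L : cantor_partial x y i <= cantor_dist x y).
  { apply growing_ineq; [apply cantor_partial_growing|apply cantor_dist_cv]. }
  assert (T : (/ 2) ^ S i <= cantor_partial x y i).
  { assert (P : forall k, 0 <= bdiff (x k) (y k) / 2 ^ S k).
    { intros k. apply Rmult_le_pos; [unfold bdiff; destruct Bool.eqb; lra|].
      apply Rlt_le, Rinv_0_lt_compat, pow_lt. lra. }
    assert (Di : bdiff (x i) (y i) / 2 ^ S i = (/ 2) ^ S i).
    { unfold bdiff. apply Bool.eqb_false_iff in D. rewrite D, pow_inv. unfold Rdiv. lra. }
    unfold cantor_partial. destruct i as [|i]; cbn [sum_f_R0].
    - rewrite Di. lra.
    - rewrite Di.
      assert (0 <= sum_f_R0 (fun k => bdiff (x k) (y k) / 2 ^ S k) i).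
      { apply cond_pos_sum. exact P. }
      lra. }
  assert (M : (/ 2) ^ n <= (/ 2) ^ S i).
  { replace n with (S i + (n - S i))%nat by lia. rewrite pow_add.
    assert (0 < (/ 2) ^ S i) by (apply pow_lt; lra).
    assert ((/ 2) ^ (n - S i) <= 1).
    { rewrite pow_inv. rewrite <- Rinv_1. apply Rinv_le_contravar; [lra|].
      apply pow_R1_Rle. lra. }
    rewrite <- (Rmult_1_r ((/ 2) ^ S i)) at 2. apply Rmult_le_compat_l; lra. }
  lra.
Qed.

(** * The shift action conjugated to the Cantor set *)

Lemma agree_shift s N : exists M, forall x y, agree M x y -> agree N (shift s x) (shift s y).
Proof.
  exists (Z.to_nat (Z.abs s) + N)%nat. intros x y H t n Ht Hn. apply H; lia.
Qed.

Lemma shift_shift s r x : shift s (shift r x) = shift (r + s) x.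
Proof.
  apply functional_extensionality; intros t. unfold shift.
  now rewrite Z.add_assoc.
Qed.

Lemma shift_0 x : shift 0 x = x.
Proof. apply functional_extensionality; intros t. reflexivity. Qed.

Theorem theorem1p2 :
  exists T : Cantor -> Cantor,
    homeomorphism T /\ topologically_mixing T /\ completely_scrambled T.
Proof.
  destruct orbit_closure_homeomorphic as (H & G & HX & GH & HG & CH & CG).
  (* All powers of the shift are conjugated at once, so that the inverse is [T (-1)] and the
     iterates are [T (Z.of_nat n)]. *)
  set (T := fun s c => G (shift s (H c))).
  assert (HT : forall s c, H (T s c) = shift s (H c)).
  { intros s c. apply HG, orbit_closure_shift, HX. }
  assert (TT : forall s r c, T s (T r c) = T (r + s)%Z c).
  { intros s r c. unfold T at 1 3. now rewrite HT, shift_shift. }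
  assert (T0 : forall c, T 0%Z c = c).
  { intros c. unfold T. now rewrite shift_0. }
  assert (CT : forall s, continuous_map (T s)).
  { intros s c eps Heps. destruct (cantor_dist_lt eps Heps) as [n Hn].
    destruct (CG n (shift s (H c))) as [N HN]; [apply orbit_closure_shift, HX|].
    destruct (agree_shift s N) as [M HM]. destruct (CH M) as [m Hm].
    destruct (cantor_dist_prefix m) as (delta & Hdelta & Hd).
    exists delta. split; [trivial|]. intros c' Hc'.
    apply Hn, HN; [apply orbit_closure_shift, HX|]. auto. }
  assert (IT : forall n c, iterT (T 1%Z) n c = T (Z.of_nat n) c).
  { intros n c. induction n as [|n IH].
    - symmetry. apply T0.
    - change (iterT (T 1%Z) (S n) c) with (T 1%Z (iterT (T 1%Z) n c)).
      rewrite IH, TT. f_equal. lia. }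
  exists (T 1%Z). split; [|split].
  - split; [apply CT|]. exists (T (-1)%Z). split; [apply CT|].
    split; intros c; rewrite TT; apply T0.
  - intros U V HU HV [u Hu] [v Hv].
    assert (B : forall W c, is_open W -> W c ->
      exists N, forall x, orbit_closure x -> agree N (H c) x -> W (G x)).
    { intros W c HW Wc. destruct (HW c Wc) as (r & Hr & Hball).
      destruct (cantor_dist_lt r Hr) as [n Hn].
      destruct (CG n (H c) (HX c)) as [N HN]. exists N. intros x Hx Hcx.
      apply Hball, Hn. rewrite <- (GH c). now apply HN. }
    destruct (B U u HU Hu) as [N HN], (B V v HV Hv) as [N' HN'].
    destruct (orbit_closure_mixing (H u) (H v) (N + N') (HX u) (HX v)) as [M HM].
    exists M. intros n Hn. destruct (HM n Hn) as (w & Hw & Huw & Hvw).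
    exists (G w). split.
    + apply HN; [trivial|]. apply agree_le with (N + N')%nat; [lia|trivial].
    + rewrite IT. unfold T. rewrite HG by trivial. apply HN'.
      * now apply orbit_closure_shift.
      * apply agree_le with (N + N')%nat; [lia|trivial].
  - intros c c' Hcc'. split.
    + intros eps Heps M. destruct (cantor_dist_lt eps Heps) as [n Hn].
      destruct (CG n infinity orbit_closure_infinity) as [N HN].
      destruct (orbit_closure_proximal (H c) (H c') N M (HX c) (HX c')) as (k & Hk & Hx & Hy).
      exists k. split; [trivial|]. rewrite !IT. apply Hn.
      apply prefix_eq_trans with (G infinity); [apply prefix_eq_sym|];
        apply HN; try apply orbit_closure_shift, HX;
        intros t m Ht Hm; symmetry; [now apply Hx|now apply Hy].
    + intros Has. apply Hcc'. rewrite <- (GH c), <- (GH c'). f_equal.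
      apply functional_extensionality; intros t.
      apply functional_extensionality; intros n.
      apply no_asymptotic; [apply HX|apply HX|].
      (* If the images under the k-th iterate are close, the shifted points agree at time 0, that
         is, the original ones agree at time k, up to label [n]. *)
      clear t n. intros n. destruct (CH n) as [m Hm].
      destruct (cantor_dist_prefix m) as (eps & Heps & He).
      destruct (Has eps Heps) as [M HM]. exists (Z.of_nat M). intros t Ht.
      specialize (HM (Z.to_nat t) ltac:(lia)). apply He, Hm in HM.
      rewrite !IT, !HT in HM. specialize (HM 0%Z n ltac:(lia) ltac:(lia)).
      unfold shift in HM. rewrite Z.add_0_r, Z2Nat.id in HM by lia. exact HM.
Qed.
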